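(* Suppose $m,\kappa\in\mathbb Z$ satisfy $\kappa>m\ge2$. Let $\eta\in\mathbb N\cup\{\infty\}$ and let $X$, $\mathscr A$, $\phi$ be as in the context. Let $M\in(0,\infty)$ and let $\{w_i\}_{i=1}^\eta$ be a system of real polynomials of degree at most $m-2$ such that $w_i(j)>0$ for all $i\in J_{[1,\eta]}$ and $j\in\mathbb N$, and $$\max\Big\{\sum_{i=1}^\eta w_i(1),\ \sup\Big\{\frac{w_i(j+1)}{w_i(j)}: i\in J_{[1,\eta]},\ j\in\mathbb N\Big\}\Big\}\le M.$$ Then there exists a measure $\mu$ on $\mathscr A$ (with $0<\mu(\{x\})<\infty$ for all $x\in X$) such that $\mu(x_{i,j})=w_i(j)$ for all $i\in J_{[1,\eta]}$, $j\in\mathbb N$, and $C_\phi\in\boldsymbol B(L^2(\mu))$ is an $m$-isometry. Moreover, there exists $t_0\in\mathbb R$ such that all the measures $\nu$ on $\mathscr A$ (with $0<\nu(\{x\})<\infty$ for all $x\in X$) for which $\nu(x_{i,j})=w_i(j)$ for all $i\in J_{[1,\eta]}$, $j\in\mathbb N$, and $C_\phi\in\boldsymbol B(L^2(\nu))$ is an $m$-isometry can be parameterized by $t\in(t_0,\infty)$ as $\mu_t$, where $$\mu_t(x)=\begin{cases}\mu(x)+t&\text{if }x=x_j\text{ with }j\in\{1,\ldots,\kappa\},\\ \mu(x)&\text{otherwise.}\end{cases}$$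
   Context: Setting. $\mathbb N=\{1,2,\ldots\}$. Given $\kappa\in\mathbb N$ and $\eta\in\mathbb N\cup\{\infty\}$, let $J_{[1,\eta]}=\{i\in\mathbb N: i\le\eta\}$ (so $J_{[1,\infty]}=\mathbb N$), and let $X=\{x_1,\ldots,x_\kappa\}\cup\{x_{i,j}: i\in J_{[1,\eta]},\, j\in\mathbb N\}$, all the listed points being distinct. Let $\mathscr A$ be the $\sigma$-algebra of all subsets of $X$. Define $\phi\colon X\to X$ by $\phi(x_{i,j})=x_{i,j-1}$ for $j\ge2$, $\phi(x_{i,1})=x_\kappa$, $\phi(x_1)=x_\kappa$, and $\phi(x_i)=x_{i-1}$ for $2\le i\le\kappa$. Measures $\mu$ on $\mathscr A$ considered are positive with $\mu(x):=\mu(\{x\})\in(0,\infty)$ for all $x\in X$. $C_\phi f=f\circ\phi$ is the composition operator in the complex space $L^2(\mu)=L^2(X,\mathscr A,\mu)$, and $C_\phi\in\boldsymbol B(L^2(\mu))$ means that it is everywhere defined and bounded on $L^2(\mu)$. A bounded operator $T$ on a Hilbert space is an $m$-isometry if $\sum_{k=0}^m(-1)^k\binom mk T^{*k}T^k=0$. *)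

(* Defs.v *)
From HB Require Import structures.
From mathcomp Require Import all_boot all_order all_algebra.
From mathcomp Require Import all_classical all_reals all_analysis.
From mathcomp.real_closed Require Import complex.

Set Implicit Arguments.
Unset Strict Implicit.
Unset Printing Implicit Defensive.

Import Order.TTheory GRing.Theory Num.Theory.
Import numFieldNormedType.Exports.

Local Open Scope classical_set_scope.
Local Open Scope complex_scope.
Local Open Scope ring_scope.

(** * The complex space L^2 of a measure space

   Elements of L^2(mu) are represented by complex functions; two functions
   represent the same element when they agree mu-almost everywhere. *)

Section ComplexL2.
Context {d : measure_display} {T : measurableType d} {R : realType}.
Variable mu : {measure set T -> \bar R}.
Implicit Types (f g : T -> R[i]) (A B : (T -> R[i]) -> (T -> R[i])).

Definition L2norm f : \bar R :=
  Lnorm mu 2%:E (fun x => (Normc.normc (f x))%:E).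

Definition L2 : set (T -> R[i]) := [set f : T -> R[i] |
  [/\ measurable_fun setT (fun x => complex.Re (f x)),
      measurable_fun setT (fun x => complex.Im (f x)) &
      (L2norm f < +oo)%E]].

Definition Cintegral f : R[i] :=
  (\int[mu]_x (complex.Re (f x)))%R +i* (\int[mu]_x (complex.Im (f x)))%R.

Definition L2inner f g : R[i] := Cintegral (fun x => f x * conjc (g x)).

(* Linearity (mu-a.e.) and the norm bound make [A] compatible with equality
   mu-almost everywhere, so that [A] does act on classes. *)
Definition L2_bounded_operator A : Prop :=
  [/\ forall f, L2 f -> L2 (A f),
      forall (a : R[i]) f g, L2 f -> L2 g ->
        {ae mu, forall x, A (fun y => a * f y + g y) x = a * A f x + A g x} &
      exists c : R, forall f, L2 f -> (L2norm (A f) <= c%:E * L2norm f)%E].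

Definition L2_adjoint A B : Prop :=
  L2_bounded_operator B /\
  forall f g, L2 f -> L2 g -> L2inner (A f) g = L2inner f (B g).

(* The adjoint [B] = A^* is determined by [A] up to equality mu-a.e. *)
Definition L2_m_isometry (m : nat) A : Prop :=
  L2_bounded_operator A /\
  exists2 B, L2_adjoint A B &
    forall f, L2 f -> {ae mu, forall x,
      \sum_(k < m.+1) (-1) ^+ k * 'C(m, k)%:R * iter k B (iter k A f) x = 0}.

Definition composition_operator (phi : T -> T) f : T -> R[i] := f \o phi.

End ComplexL2.

(** * The set X and the map phi *)

(* [Some n] stands for eta = n and [None] for eta = oo. *)
Definition J (eta : option nat) :=
  {i : nat | (0 < i)%N && (if eta is Some n then (i <= n)%N else true)}.

HB.instance Definition _ eta := Countable.on (J eta).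

(* The second index of x_{i,j} and the index of x_i start from 0 here:
   [Core i] is x_{i+1} and [Branch i j] is x_{i,j+1}.  For kappa >= 1 the type
   'I_kappa.-1.+1 has kappa elements, and [ord_max] is the index of x_kappa. *)
Inductive vertex (kappa : nat) (eta : option nat) : Type :=
| Core of 'I_kappa.-1.+1
| Branch of J eta & nat.
Arguments Core {kappa eta} _.
Arguments Branch {kappa eta} _ _.

Section VertexInstances.
Variables (kappa : nat) (eta : option nat).

Definition sum_of_vertex (x : vertex kappa eta) : 'I_kappa.-1.+1 + J eta * nat :=
  match x with Core i => inl i | Branch i j => inr (i, j) end.

Definition vertex_of_sum (s : 'I_kappa.-1.+1 + J eta * nat) : vertex kappa eta :=
  match s with inl i => Core i | inr (i, j) => Branch i j end.

Lemma sum_of_vertexK : cancel sum_of_vertex vertex_of_sum.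
Proof. by case. Qed.

HB.instance Definition _ := Countable.copy (vertex kappa eta)
  (can_type sum_of_vertexK).
HB.instance Definition _ := isPointed.Build (vertex kappa eta) (Core ord0).
HB.instance Definition _ := @isMeasurable.Build default_measure_display
  (vertex kappa eta) discrete_measurable discrete_measurable0
  discrete_measurableC discrete_measurableU.

End VertexInstances.

Definition phi (kappa : nat) (eta : option nat) (x : vertex kappa eta) :
    vertex kappa eta :=
  match x with
  | Branch i j.+1 => Branch i j
  | Branch i 0 => Core ord_max
  | Core i => if i == ord0 then Core ord_max else Core (inord i.-1)
  end.

Section Measures.
Context {R : realType} {kappa : nat} {eta : option nat}.
Implicit Types mu nu : {measure set (vertex kappa eta) -> \bar R}.

Definition positive_masses mu : Prop :=
  forall x, (0 < mu [set x] < +oo)%E.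

(* mu(x_{i,j}) = w_i(j) for j >= 1 *)
Definition branch_masses (w : J eta -> {poly R}) mu : Prop :=
  forall i (j : nat), mu [set Branch i j] = ((w i).[j.+1%:R])%:E.

Definition m_isometric_extension (m : nat) (w : J eta -> {poly R}) mu : Prop :=
  [/\ positive_masses mu, branch_masses w mu &
      L2_m_isometry mu m (composition_operator (@phi kappa eta))].

(* [nu] is the measure mu_t *)
Definition is_core_shift mu (t : R) nu : Prop :=
  forall x, nu [set x] =
    (if x is Core _ then mu [set x] + t%:E else mu [set x])%E.

End Measures.

(* Main.v *)
Require Import Defs.
From mathcomp Require Import all_boot all_order all_algebra.
From mathcomp Require Import all_classical all_reals all_analysis.
From mathcomp.real_closed Require Import complex.
From mathcomp Require Import ring lra.

Set Implicit Arguments.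
Unset Strict Implicit.
Unset Printing Implicit Defensive.

Import Order.TTheory GRing.Theory Num.Theory.
Import numFieldNormedType.Exports.

Local Open Scope classical_set_scope.
Local Open Scope ring_scope.

(** Since every point has positive mass and the space is countable, everything
    can be tested on atoms.  If A is the operator of composition with phi and B
    its adjoint, then pairing B^k A^k f with the indicator of x gives
      mu(x) (B^k A^k f)(x) = mu(phi^-k(x)) f(x),
    so A is an m-isometry exactly when it is bounded and, for all x,
      sum_k (-1)^k C(m,k) mu(phi^-k(x)) = 0
    ([m_isometry_preimage], [preimage_m_isometry]).

    On the branches this is the vanishing of the m-th difference of a
    polynomial of degree less than m.  On the core, number the points from 0 to
    kappa-1, let a p be the mass of the p-th one and W j the total mass of the
    points at height j of the branches, heights being counted from 0.  Going
    backwards along phi moves up the cycle; the step from the last core point to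
    the first one also adds the points at height 0 of the branches, which climb
    with the following steps.  So mu(phi^-k(core p)) = g(p + k) for k <= kappa,
    where g p = a p and g(kappa + j) = a j + W j for 0 <= p, j < kappa
    ([preimage_core_mass]).  As m < kappa, the condition is that the m-th
    differences of g vanish at 0, ..., kappa-1.

    The function W is a convergent sum of polynomials of degree at most m-2,
    hence its (m-1)-st differences vanish ([iter_fdiff_level_mass]).  Therefore
    W is the increment g(kappa + j) - g(j) of some g whose m-th differences
    vanish ([polynomial_coboundary]), and g provides core masses up to an
    additive constant, which can be chosen to make them positive.  Conversely the
    difference of two solutions extends to a kappa-periodic sequence with
    vanishing m-th differences, and a periodic polynomial is constant
    ([periodic_fdiff_const]).  So the solutions form one orbit of translation by
    constants, cut down to a half-line by positivity: t0 is minus the least core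
    mass of mu. *)

(** * Integration on a countable discrete space *)

Section CountableDiscrete.
Context d (T : measurableType d) (R : realType).
Variable mu : {measure set T -> \bar R}.
Hypothesis measurable_all : forall A : set T, measurable A.
Variable code : T -> nat.
Hypothesis code_inj : injective code.

Lemma measurable_fun_discrete d' (U : measurableType d') (D : set T) (f : T -> U) :
  measurable_fun D f.
Proof. by move=> _ Y _; exact: measurable_all. Qed.

Local Hint Resolve measurable_all measurable_fun_discrete : core.

Lemma integral_singleton (f : T -> \bar R) (a : T) :
  (\int[mu]_(x in [set a]) f x = f a * mu [set a])%E.
Proof.
rewrite -integral_cst//; apply: eq_integral => x; rewrite inE/= => -> //.
Qed.

(* The fibres of [code \o g] are those of [g], listed along nat and padded
   with empty sets. *)
Let fiber (g : T -> T) (n : nat) : set T := [set y | code (g y) = n].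

Let fiberE g a : fiber g (code a) = g @^-1` [set a].
Proof.
rewrite /fiber /preimage; apply/seteqP; split=> [y|y]; rewrite /=.
  exact: code_inj.
by move=> ->.
Qed.

Let fiber0 g n : ~ (exists a, code a = n) -> fiber g n = set0.
Proof. by move=> na; apply/seteqP; split=> y //= gy; case: na; exists (g y). Qed.

Let fiberT g : \bigcup_n fiber g n = setT.
Proof. by apply/seteqP; split=> y // _; exists (code (g y)). Qed.

Let fiber_triv g : trivIset setT (fiber g).
Proof. by move=> i j _ _ [y [/= <- <-]]. Qed.

Let ge0_integral_fiber g (u : T -> \bar R) : (forall y, 0 <= u y)%E ->
  (\int[mu]_y u y = \sum_(n <oo) \int[mu]_(y in fiber g n) u y)%E.
Proof. by move=> u0; rewrite -ge0_integral_bigcup// fiberT. Qed.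

(** Two integrals are compared by cutting the space along two different maps
    with the same set of values; used with one map phi and the other the
    identity, which moves a sum over the fibres of phi to a sum over points. *)
Lemma ge0_le_integral_fibers (g h : T -> T) (u v : T -> \bar R) :
  (forall y, 0 <= u y)%E -> (forall y, 0 <= v y)%E ->
  (forall x, \int[mu]_(y in g @^-1` [set x]) u y
          <= \int[mu]_(y in h @^-1` [set x]) v y)%E ->
  (\int[mu]_y u y <= \int[mu]_y v y)%E.
Proof.
move=> u0 v0 uv; rewrite (ge0_integral_fiber g u0) (ge0_integral_fiber h v0).
apply: lee_nneseries => [n _ _|n _]; first exact: integral_ge0.
have [[a <-]|na] := pselect (exists a, code a = n); first by rewrite !fiberE.
by rewrite !fiber0// !integral_set0.
Qed.

Lemma eq_integral_fibers (g h : T -> T) (u v : T -> \bar R) :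
  mu.-integrable setT u -> mu.-integrable setT v ->
  (forall x, \int[mu]_(y in g @^-1` [set x]) u y
           = \int[mu]_(y in h @^-1` [set x]) v y)%E ->
  (\int[mu]_y u y = \int[mu]_y v y)%E.
Proof.
move=> iu iv uv; rewrite -[in LHS](fiberT g) -[in RHS](fiberT h).
rewrite !integral_bigcup ?fiberT//.
apply: eq_eseriesr => n _.
have [[a <-]|na] := pselect (exists a, code a = n); first by rewrite !fiberE.
by rewrite !fiber0// !integral_set0.
Qed.

Definition square_integrable (u : T -> R) : Prop :=
  (\int[mu]_x ((u x) ^+ 2)%:E < +oo)%E.

Lemma square_integrableP (D : set T) u : square_integrable u ->
  mu.-integrable D (fun x => ((u x) ^+ 2)%:E).
Proof.
move=> su; apply: (@integrableS _ _ _ _ setT) => //.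
apply/integrableP; split => //.
by under eq_integral do rewrite gee0_abs ?lee_fin ?sqr_ge0//.
Qed.

Lemma integrable_prod_square u v : square_integrable u -> square_integrable v ->
  mu.-integrable setT (fun x => (u x * v x)%:E).
Proof.
move=> su sv.
apply: (le_integrable _ _ _ (integrableD _ (square_integrableP setT su)
  (square_integrableP setT sv))) => // x _.
rewrite /= lee_fin [leRHS]ger0_norm ?addr_ge0 ?sqr_ge0//.
rewrite normrM -(real_normK (num_real (u x))) -(real_normK (num_real (v x))).
nra.
Qed.

Lemma integrable_cst_finite (D : set T) (r : R) : (mu D < +oo)%E ->
  mu.-integrable D (fun=> r%:E).
Proof.
move=> fD; apply/integrableP; split=> //.
by rewrite integral_cst// lte_mul_pinfty.
Qed.

Lemma integrable_square_finite (D : set T) u : (mu D < +oo)%E ->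
  square_integrable u -> mu.-integrable D (fun x => (u x)%:E).
Proof.
move=> fD su.
apply: (le_integrable _ _ _ (integrableD _
  (integrable_cst_finite 1 fD) (square_integrableP D su))) => // x _.
rewrite /= lee_fin [leRHS]ger0_norm ?addr_ge0 ?sqr_ge0//.
rewrite -(real_normK (num_real (u x))); have := normr_ge0 (u x).
nra.
Qed.

(** The integral over [D] of the square of [u - l] is nonnegative for each [l];
    take for [l] the mean value of [u]. *)
Lemma cauchy_schwarz_finite (D : set T) u : (mu D < +oo)%E ->
  square_integrable u ->
  (\int[mu]_(x in D) u x) ^+ 2 <= fine (mu D) * \int[mu]_(x in D) (u x) ^+ 2.
Proof.
move=> fD su.
have iu := integrable_square_finite fD su.
have iu2 := square_integrableP D su.
set a := Rintegral _ _ _; set s := Rintegral _ _ _; set p := fine _.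
have sq0 l : 0 <= s - 2 * l * a + l ^+ 2 * p.
  have -> : s - 2 * l * a + l ^+ 2 * p = \int[mu]_(x in D) (u x - l) ^+ 2.
    rewrite [RHS](_ : _ = \int[mu]_(x in D) ((u x) ^+ 2 - 2 * l * u x + l ^+ 2)).
      rewrite RintegralD//; last 2 first.
      - exact: (integrableB _ iu2 (integrableZl _ (2 * l) iu)).
      - exact: integrable_cst_finite.
      rewrite RintegralB//; last exact: (integrableZl _ (2 * l) iu).
      by rewrite RintegralZl// Rintegral_cst.
    by apply: eq_Rintegral => x _; ring.
  by apply: Rintegral_ge0 => x _; rewrite sqr_ge0.
have p0 : 0 <= p by rewrite fine_ge0.
have [pE|pN0] := eqVneq p 0.
  have muD0 : mu D = 0 by rewrite -(@fineK _ (mu D)) ?ge0_fin_numE// -/p pE.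
  rewrite /a /Rintegral null_set_integral// ?expr0n ?mul0r ?pE ?mul0r//.
have pp : 0 < p by rewrite lt_def pN0.
have := sq0 (a / p); rewrite -(pmulr_rge0 _ pp).
suff -> : p * (s - 2 * (a / p) * a + (a / p) ^+ 2 * p) = p * s - a ^+ 2.
  by rewrite subr_ge0.
by field.
Qed.

(** * Composition operators and their adjoints *)

Lemma L2normE (f : T -> R[i]) :
  L2norm mu f = ((\int[mu]_x ((complex.Re (f x)) ^+ 2)%:E +
                 \int[mu]_x ((complex.Im (f x)) ^+ 2)%:E) `^ 2^-1)%E.
Proof.
rewrite /L2norm Lnorm.unlock /=; congr (_ `^ _)%E.
rewrite -ge0_integralD//; last 2 first.
- by move=> x _; rewrite lee_fin sqr_ge0.
- by move=> x _; rewrite lee_fin sqr_ge0.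
apply: eq_integral => x _; case: (f x) => a b /=.
rewrite ger0_norm ?sqrtr_ge0// powR_mulrn ?sqrtr_ge0//.
by rewrite sqr_sqrtr ?addr_ge0 ?sqr_ge0// EFinD.
Qed.

Lemma L2P (f : T -> R[i]) : L2 mu f <->
  square_integrable (fun x => complex.Re (f x)) /\
  square_integrable (fun x => complex.Im (f x)).
Proof.
have re0 : (0 <= \int[mu]_x ((complex.Re (f x)) ^+ 2)%:E)%E.
  by apply: integral_ge0 => x _; rewrite lee_fin sqr_ge0.
have im0 : (0 <= \int[mu]_x ((complex.Im (f x)) ^+ 2)%:E)%E.
  by apply: integral_ge0 => x _; rewrite lee_fin sqr_ge0.
split=> [[_ _]|[sr si]].
  rewrite L2normE => /lty_poweRy; rewrite invr_eq0 pnatr_eq0 => /(_ isT) fi.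
  by split; apply: le_lt_trans fi; rewrite ?leeDl ?leeDr.
by split=> //; rewrite L2normE; apply: poweR_lty; exact: lte_add_pinfty.
Qed.

(** The operators below act separately on real and imaginary parts, which
    reduces their boundedness to real functions. *)
Lemma L2norm_le_parts (f h : T -> R[i]) (c : R) : 0 <= c ->
  (\int[mu]_x ((complex.Re (h x)) ^+ 2)%:E <=
     c%:E * \int[mu]_x ((complex.Re (f x)) ^+ 2)%:E)%E ->
  (\int[mu]_x ((complex.Im (h x)) ^+ 2)%:E <=
     c%:E * \int[mu]_x ((complex.Im (f x)) ^+ 2)%:E)%E ->
  (L2norm mu h <= (c `^ 2^-1)%:E * L2norm mu f)%E.
Proof.
move=> c0 hre him; rewrite !L2normE -poweR_EFin -poweRM//; last first.
  by apply: adde_ge0; apply: integral_ge0 => x _; rewrite lee_fin sqr_ge0.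
have pos (u : T -> R) : (0 <= \int[mu]_x ((u x) ^+ 2)%:E)%E.
  by apply: integral_ge0 => x _; rewrite lee_fin sqr_ge0.
apply: gt0_ler_poweR; first by rewrite invr_ge0.
- by rewrite in_itv /= leey andbT adde_ge0.
- by rewrite in_itv /= leey andbT; apply: mule_ge0; [exact: c0|exact: adde_ge0].
by rewrite ge0_muleDr//; exact: leeD.
Qed.

Hypothesis mass_pos : forall x, (0 < mu [set x] < +oo)%E.

Let mass x := fine (mu [set x]).

Let massE x : mu [set x] = (mass x)%:E.
Proof. by have /andP[x0 xoo] := mass_pos x; rewrite fineK// ge0_fin_numE// ltW. Qed.

Let mass_gt0 x : 0 < mass x.
Proof. by have /andP[] := mass_pos x; rewrite massE lte_fin. Qed.

Lemma ae_everywhere (P : T -> Prop) : {ae mu, forall x, P x} -> forall x, P x.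
Proof.
move=> [N [mN N0 PN]] x; apply: contrapT => nPx.
have /andP[+ _] := mass_pos x; rewrite ltNge => /negP; apply.
by rewrite -N0; apply: le_measure; rewrite ?inE// => _ ->; exact: PN.
Qed.

Variable phi : T -> T.

Section BoundedFibers.
Variable c : R.
Hypothesis c_ge0 : 0 <= c.
Hypothesis fiber_le : forall x, (mu (phi @^-1` [set x]) <= c%:E * mu [set x])%E.

Let fiber_lty x : (mu (phi @^-1` [set x]) < +oo)%E.
Proof. by apply: le_lt_trans (fiber_le x) _; rewrite massE -EFinM ltry. Qed.

Let fiber_mass_le x : fine (mu (phi @^-1` [set x])) <= c * mass x.
Proof.
by rewrite -lee_fin fineK ?ge0_fin_numE// EFinM -massE; exact: fiber_le.
Qed.

Lemma composition_square_le (u : T -> R) :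
  (\int[mu]_x ((u (phi x)) ^+ 2)%:E <= c%:E * \int[mu]_x ((u x) ^+ 2)%:E)%E.
Proof.
rewrite -ge0_integralZl//; last by move=> x _; rewrite lee_fin sqr_ge0.
apply: (@ge0_le_integral_fibers phi id) => [y|y|x].
- by rewrite lee_fin sqr_ge0.
- by rewrite mule_ge0// lee_fin sqr_ge0.
rewrite preimage_id integral_singleton muleAC.
under eq_integral => y do [rewrite inE /= => ->].
by rewrite integral_cst// muleC; apply: lee_pmul; rewrite ?lee_fin ?sqr_ge0.
Qed.

(** The adjoint of the composition with phi, on real functions.  It is the mean
    value over the fibre only up to the factor mu(phi^-1(x)) / mu(x). *)
Definition fiber_average (v : T -> R) (x : T) : R :=
  (\int[mu]_(y in phi @^-1` [set x]) v y) / mass x.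

(** By Cauchy-Schwarz on the fibre over x, mu(x) times the square of the average
    is at most mu(phi^-1(x)) / mu(x) <= c times the integral of v^2 there. *)
Lemma fiber_average_square_le (v : T -> R) : square_integrable v ->
  (\int[mu]_x ((fiber_average v x) ^+ 2)%:E <= c%:E * \int[mu]_x ((v x) ^+ 2)%:E)%E.
Proof.
move=> sv; rewrite -ge0_integralZl//; last by move=> x _; rewrite lee_fin sqr_ge0.
apply: (@ge0_le_integral_fibers id phi) => [y|y|x].
- by rewrite lee_fin sqr_ge0.
- by rewrite mule_ge0// lee_fin sqr_ge0.
rewrite preimage_id integral_singleton massE -EFinM.
have i2 := square_integrableP (phi @^-1` [set x]) sv.
rewrite integralZl// -[X in (_ <= _ * X)%E]fineK; last exact: integrable_fin_num.
rewrite -EFinM lee_fin /fiber_average.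
have := cauchy_schwarz_finite (fiber_lty x) sv.
rewrite /Rintegral.
set a := fine (integral _ _ (fun x => (v x)%:E)); set s := fine (integral _ _ _).
move=> as2; have -> : (a / mass x) ^+ 2 * mass x = a ^+ 2 / mass x.
  by field; rewrite gt_eqF.
rewrite ler_pdivrMr//; apply: le_trans as2 _.
rewrite mulrAC ler_wpM2r// /s.
by apply: fine_ge0; apply: integral_ge0 => y _; rewrite lee_fin sqr_ge0.
Qed.

(** On the fibre over x the factor u (phi y) is the constant u x. *)
Lemma fiber_average_adjoint (u v : T -> R) :
  square_integrable u -> square_integrable v ->
  \int[mu]_x (u (phi x) * v x) = \int[mu]_x (u x * fiber_average v x).
Proof.
move=> su sv; congr fine.
have suphi : square_integrable (u \o phi).
  by apply: le_lt_trans (composition_square_le u) _; rewrite lte_mul_pinfty.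
have sEv : square_integrable (fiber_average v).
  by apply: le_lt_trans (fiber_average_square_le sv) _; rewrite lte_mul_pinfty.
apply: (@eq_integral_fibers phi id) => [||x].
- exact: (integrable_prod_square suphi sv).
- exact: (integrable_prod_square su sEv).
have iv := integrable_square_finite (fiber_lty x) sv.
rewrite preimage_id integral_singleton massE.
under eq_integral => y do [rewrite inE /= => ->; rewrite EFinM].
rewrite integralZl// -[X in (_ * X)%E]fineK; last exact: integrable_fin_num.
rewrite -!EFinM /fiber_average; congr EFin.
by rewrite -mulrA divfK ?gt_eqF.
Qed.

Definition composition_adjoint (f : T -> R[i]) (x : T) : R[i] :=
  Complex (fiber_average (fun y => complex.Re (f y)) x)
          (fiber_average (fun y => complex.Im (f y)) x).

Lemma composition_bounded : L2_bounded_operator mu (composition_operator phi).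
Proof.
have le1 (f : T -> R[i]) : (L2norm mu (composition_operator phi f) <=
    (c `^ 2^-1)%:E * L2norm mu f)%E.
  apply: L2norm_le_parts => //.
    exact: (composition_square_le (fun y => complex.Re (f y))).
  exact: (composition_square_le (fun y => complex.Im (f y))).
split=> [f [_ _ fl]|a f g _ _|].
- split=> //; apply: le_lt_trans (le1 f) _.
  by rewrite lte_mul_pinfty// lee_fin powR_ge0.
- exact: aeW.
- by exists (c `^ 2^-1) => f _.
Qed.

Lemma composition_adjoint_bounded : L2_bounded_operator mu composition_adjoint.
Proof.
have le1 (f : T -> R[i]) : L2 mu f -> (L2norm mu (composition_adjoint f) <=
    (c `^ 2^-1)%:E * L2norm mu f)%E.
  move=> /L2P[sr si]; apply: L2norm_le_parts => //;
    exact: fiber_average_square_le.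
split=> [f Lf|a f g /L2P[fr fi] /L2P[gr gi]|].
- split=> //; apply: le_lt_trans (le1 f Lf) _; case: Lf => _ _ fl.
  by rewrite lte_mul_pinfty// lee_fin powR_ge0.
- apply: aeW => x; rewrite /composition_adjoint /fiber_average.
  set F := phi @^-1` [set x].
  have int u : square_integrable u -> mu.-integrable F (EFin \o u).
    by move=> /(integrable_square_finite (fiber_lty x)).
  have intZ (r : R) u : square_integrable u ->
      mu.-integrable F (EFin \o (fun y => r * u y)).
    by move=> /int iu; exact: (integrableZl _ r iu).
  apply/eqP; rewrite eq_complex /=; apply/andP; split; apply/eqP.
    transitivity ((complex.Re a * \int[mu]_(y in F) complex.Re (f y)
       - complex.Im a * \int[mu]_(y in F) complex.Im (f y)
       + \int[mu]_(y in F) complex.Re (g y)) / mass x).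
      congr (_ / _); rewrite -!RintegralZl ?int//.
      rewrite -RintegralB ?intZ// -RintegralD ?(int _ gr)//.
        by apply: eq_Rintegral => y _; case: (a) (f y) (g y) => [? ?] [? ?] [? ?].
      exact: (integrableB _ (intZ _ _ fr) (intZ _ _ fi)).
    by case: (a) => a1 a2 /=; ring.
  transitivity ((complex.Re a * \int[mu]_(y in F) complex.Im (f y)
       + complex.Im a * \int[mu]_(y in F) complex.Re (f y)
       + \int[mu]_(y in F) complex.Im (g y)) / mass x).
    congr (_ / _); rewrite -!RintegralZl ?int//.
    rewrite -RintegralD ?intZ// -RintegralD ?(int _ gi)//.
      by apply: eq_Rintegral => y _; case: (a) (f y) (g y) => [? ?] [? ?] [? ?].
    exact: (integrableD _ (intZ _ _ fi) (intZ _ _ fr)).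
  by case: (a) => a1 a2 /=; ring.
- by exists (c `^ 2^-1).
Qed.

Lemma composition_adjointP :
  L2_adjoint mu (composition_operator phi) composition_adjoint.
Proof.
split; first exact: composition_adjoint_bounded.
move=> f g Lf Lg.
have [AL _ _] := composition_bounded.
have [BL _ _] := composition_adjoint_bounded.
have /L2P[Afr Afi] := AL _ Lf; have /L2P[Bgr Bgi] := BL _ Lg.
move: Lf Lg => /L2P[fr fi] /L2P[gr gi].
have int u v := @integrable_prod_square u v.
apply/eqP; rewrite eq_complex /=; apply/andP; split; apply/eqP.
  transitivity (\int[mu]_x (complex.Re (f (phi x)) * complex.Re (g x))
              + \int[mu]_x (complex.Im (f (phi x)) * complex.Im (g x))).
    rewrite -RintegralD ?int//; apply: eq_Rintegral => y _.
    by rewrite /composition_operator /=; case: (f _) (g _) => [? ?] [? ?] /=; ring.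
  rewrite (fiber_average_adjoint fr gr) (fiber_average_adjoint fi gi).
  rewrite -RintegralD ?int//; apply: eq_Rintegral => y _.
  by case: (f _) => [? ?] /=; ring.
transitivity (\int[mu]_x (complex.Im (f (phi x)) * complex.Re (g x))
              - \int[mu]_x (complex.Re (f (phi x)) * complex.Im (g x))).
  rewrite -RintegralB ?int//; apply: eq_Rintegral => y _.
  by rewrite /composition_operator /=; case: (f _) (g _) => [? ?] [? ?] /=; ring.
rewrite (fiber_average_adjoint fi gr) (fiber_average_adjoint fr gi).
rewrite -RintegralB ?int//; apply: eq_Rintegral => y _.
by case: (f _) => [? ?] /=; ring.
Qed.

End BoundedFibers.

(** * The m-isometry condition on atoms *)

Let point_indic (x y : T) : R[i] := ((\1_[set x] y : R)%:C)%C.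

Lemma indic_square_integrable (A : set T) : (mu A < +oo)%E ->
  square_integrable (\1_A : T -> R).
Proof.
move=> fA; rewrite /square_integrable.
rewrite [X in (X < _)%E](_ : _ = mu A)//.
rewrite -[RHS](_ : (\int[mu]_(x in setT) (\1_A x)%:E = mu A)%E); last first.
  by rewrite integral_indic// setIT.
apply: eq_integral => x _; congr EFin.
by rewrite indicE; case: (_ \in _); rewrite ?expr1n ?expr0n.
Qed.

Let point_indic_L2 x : L2 mu (point_indic x).
Proof.
apply/L2P; split; last first.
  rewrite /square_integrable /=; under eq_integral do rewrite expr0n.
  by rewrite integral0 ltry.
by apply: indic_square_integrable; have /andP[] := mass_pos x.
Qed.

Lemma Cintegral_indic (A : set T) (h : T -> R[i]) (z : R[i]) :
  (forall y, A y -> h y = z) ->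
  Cintegral mu (fun y => ((\1_A y : R)%:C)%C * h y) = z * ((fine (mu A))%:C)%C.
Proof.
move=> hz; have part (u : R[i] -> R) : u 0 = 0 ->
    \int[mu]_y u (((\1_A y : R)%:C)%C * h y) = u z * fine (mu A).
  move=> u0; rewrite -(Rintegral_cst mu)// [RHS]Rintegral_mkcond.
  apply: eq_Rintegral => y _; rewrite patchE indicE.
  by case: ifPn => [/set_mem /hz ->|_]; rewrite ?mul1r ?mul0r ?u0.
rewrite /Cintegral (part (@complex.Re R))// (part (@complex.Im R))//.
by case: z {hz part} => a b; apply/eqP; rewrite eq_complex /= !mulr0 subr0 add0r !eqxx.
Qed.

Lemma iter_composition k (f : T -> R[i]) :
  iter k (composition_operator phi) f = f \o iter k phi.
Proof.
elim: k => // k IH; rewrite iterS IH; apply/funext => x.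
by rewrite [RHS]/comp iterSr.
Qed.

Section Adjoint.
Variable B : (T -> R[i]) -> (T -> R[i]).
Hypothesis bA : L2_bounded_operator mu (composition_operator phi).
Hypothesis adjB : L2_adjoint mu (composition_operator phi) B.

Let A_L2 f k : L2 mu f -> L2 mu (iter k (composition_operator phi) f).
Proof. by move=> Lf; elim: k => //= k; case: bA => AL _ _; exact: AL. Qed.

Let B_L2 f k : L2 mu f -> L2 mu (iter k B f).
Proof. by move=> Lf; elim: k => //= k; case: adjB => -[BL _ _] _; exact: BL. Qed.

Lemma L2_adjoint_iter k f g : L2 mu f -> L2 mu g ->
  L2inner mu (iter k (composition_operator phi) f) g = L2inner mu f (iter k B g).
Proof.
move=> Lf; elim: k g => // k IH g Lg.
rewrite iterS iterSr; case: adjB => -[BL _ _] adj.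
by rewrite adj ?IH//; [exact: BL | exact: A_L2].
Qed.

(** Both sides are, up to conjugation, the inner product of A^k 1_x and A^k f,
    computed with and without moving A^k to the other side.  [B] is an
    arbitrary adjoint, as provided by an arbitrary m-isometric extension. *)
Lemma adjoint_power_power k f x : L2 mu f ->
  iter k B (iter k (composition_operator phi) f) x * ((mass x)%:C)%C =
  f x * ((fine (mu (iter k phi @^-1` [set x])))%:C)%C.
Proof.
move=> Lf.
have := L2_adjoint_iter k (point_indic_L2 x) (A_L2 k Lf).
set G := iter k B _; rewrite !iter_composition /L2inner.
rewrite (@Cintegral_indic [set x] (fun y => conjc (G y)) (conjc (G x))); last by move=> y ->.
rewrite (_ : (fun _ => _) = (fun y =>
    ((\1_(iter k phi @^-1` [set x]) y : R)%:C)%C * conjc (f (iter k phi y)))); last first.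
  by apply/funext => y /=; rewrite /point_indic !indicE.
rewrite (@Cintegral_indic _ (fun y => conjc (f (iter k phi y))) (conjc (f x))); last first.
  by move=> y /= ->.
move=> /(congr1 (@conjc R)).
by rewrite !rmorphM /= !conjcK !oppr0 => ->.
Qed.

End Adjoint.

(** The alternating sum whose vanishing at every point is the m-isometry
    condition. *)
Definition preimage_difference (m : nat) (x : T) : R :=
  \sum_(k < m.+1) (-1) ^+ k * 'C(m, k)%:R * fine (mu (iter k phi @^-1` [set x])).

Lemma m_isometry_defect B m f x :
  L2_bounded_operator mu (composition_operator phi) ->
  L2_adjoint mu (composition_operator phi) B -> L2 mu f ->
  (\sum_(k < m.+1) (-1) ^+ k * 'C(m, k)%:R *
     iter k B (iter k (composition_operator phi) f) x) * ((mass x)%:C)%C =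
  f x * ((preimage_difference m x)%:C)%C.
Proof.
move=> bA adjB Lf; rewrite mulr_suml /preimage_difference rmorph_sum mulr_sumr.
apply: eq_bigr => k _; rewrite -mulrA adjoint_power_power//.
by rewrite !rmorphM rmorphXn rmorphN1 rmorph_nat; ring.
Qed.

Lemma m_isometry_preimage m : L2_m_isometry mu m (composition_operator phi) ->
  forall x, preimage_difference m x = 0.
Proof.
move=> [bA [B adjB isoB]] x.
have Lx := point_indic_L2 x.
have := m_isometry_defect m x bA adjB Lx.
rewrite (ae_everywhere (isoB _ Lx)) mul0r /point_indic indicE mem_set//= mul1r.
by move=> /(congr1 (@complex.Re R)).
Qed.

Lemma preimage_m_isometry (c : R) m : 0 <= c ->
  (forall x, mu (phi @^-1` [set x]) <= c%:E * mu [set x])%E ->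
  (forall x, preimage_difference m x = 0) ->
  L2_m_isometry mu m (composition_operator phi).
Proof.
move=> c0 fib pd0.
have bA := composition_bounded c0 fib; have adjB := composition_adjointP c0 fib.
split=> //; exists composition_adjoint => // f Lf; apply: aeW => x.
have := m_isometry_defect m x bA adjB Lf; rewrite pd0 mulr0 => /eqP.
rewrite mulf_eq0 => /orP[/eqP//|/eqP /(congr1 (@complex.Re R)) /= m0].
by have := mass_gt0 x; rewrite m0 ltxx.
Qed.

End CountableDiscrete.

(** * Finite differences *)

Section Differences.
Context {R : realType}.
Implicit Types (f g : nat -> R).

(** The sign is opposite to the usual forward difference, so that its iterates
    carry the signs (-1)^k of the m-isometry condition. *)
Definition fdiff f (j : nat) : R := f j - f j.+1.

Lemma iter_fdiffE m f p : iter m fdiff f p =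
  \sum_(k < m.+1) (-1) ^+ k * 'C(m, k)%:R * f (p + k)%N.
Proof.
elim: m f => [|m IH] f.
  by rewrite big_ord_recl big_ord0 /= bin0 mulr1 mul1r addn0 addr0.
rewrite iterSr IH [RHS]big_ord_recl /= bin0 !mul1r addn0.
under [in RHS]eq_bigr => k _.
  rewrite /bump /= add1n addnS binS natrD exprS mulN1r mulrDr mulrDl !mulNr.
  over.
rewrite big_split /= addrA.
under eq_bigr => k _ do rewrite /fdiff mulrBr.
rewrite big_split /= [X in _ + X]sumrN [X in _ = _ + X]sumrN; congr (_ - _).
rewrite big_ord_recl /= bin0 !mul1r addn0; congr (_ + _).
rewrite [RHS]big_ord_recr /= bin_small// mulr0 mul0r oppr0 addr0.
by apply: eq_bigr => k _; rewrite /bump /= add1n exprS mulN1r !mulNr addnS.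
Qed.

Lemma iter_fdiffDc n f (c : R) p :
  iter n.+1 fdiff (fun j => f j + c) p = iter n.+1 fdiff f p.
Proof.
rewrite !iterSr; congr (iter n fdiff _ p); apply/funext => j.
by rewrite /fdiff; ring.
Qed.

Lemma iter_fdiffB n f g p :
  iter n fdiff (fun j => f j - g j) p = iter n fdiff f p - iter n fdiff g p.
Proof. by elim: n p => //= n IH p; rewrite /fdiff !IH; ring. Qed.

Lemma iter_fdiff0 n p : iter n fdiff (fun=> 0) p = 0.
Proof. by elim: n p => //= n IH p; rewrite /fdiff !IH subrr. Qed.

Lemma eq_iter_fdiff n f g p : (forall j, (j <= n)%N -> f (p + j)%N = g (p + j)%N) ->
  iter n fdiff f p = iter n fdiff g p.
Proof.
move=> fg; rewrite !iter_fdiffE; apply: eq_bigr => k _.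
by rewrite fg// -ltnS.
Qed.

Lemma size_poly_sub_shift n (q : {poly R}) : (size q <= n.+1)%N ->
  (size (q - (q \Po ('X + 1%:P)))%R <= n)%N.
Proof.
move=> qn; have s2 : size ('X + 1%:P : {poly R}) = 2 by rewrite size_XaddC.
apply/leq_sizeP => i; rewrite leq_eqVlt => /orP[/eqP <-|ni].
  (* degree n: the two leading coefficients cancel *)
  rewrite coefB; move: qn; rewrite leq_eqVlt => /orP[/eqP sq|].
    have -> : n = (size q).-1 by rewrite sq.
    rewrite -[X in _ - (_)`_X.-1](size_comp_poly2 q s2) -!/(lead_coef _).
    by rewrite lead_coef_comp ?s2// lead_coefXaddC expr1n mulr1 subrr.
  by rewrite ltnS => qn; rewrite !nth_default ?subrr// size_comp_poly2.
rewrite coefB !nth_default ?subrr// ?size_comp_poly2//; exact: leq_trans qn ni.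
Qed.

Lemma iter_fdiff_poly n (q : {poly R}) (x : R) p : (size q <= n)%N ->
  iter n fdiff (fun j => q.[x + j%:R]) p = 0.
Proof.
elim: n q p => [|n IH] q p.
  by rewrite leqn0 size_poly_eq0 => /eqP -> /=; rewrite horner0.
move=> /size_poly_sub_shift sq; rewrite iterSr -[RHS](IH _ p sq).
congr (iter n fdiff _ p); apply/funext => j.
by rewrite /fdiff hornerD hornerN horner_comp !hornerE -addrA -natr1.
Qed.

Lemma iter_fdiff_cvg (S : nat -> nat -> R) (W : nat -> R) :
  (forall j, S N j @[N --> \oo] --> W j) ->
  forall n p, iter n fdiff (S N) p @[N --> \oo] --> iter n fdiff W p.
Proof.
by move=> SW; elim=> [|n IH] p //=; apply: cvgB; exact: IH.
Qed.

Lemma fdiff_sum f p : f p = f 0 - \sum_(i < p) fdiff f i.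
Proof.
elim: p => [|p IH]; first by rewrite big_ord0 subr0.
by rewrite big_ord_recr /= opprD addrA -IH /fdiff; ring.
Qed.

(** Solves g(kap + j) - g(j) = W(j) among polynomial sequences, by induction on
    the degree: g is a primitive of a solution for the differences of W, plus a
    linear term.  The slope adjusts the equation at j = 0, and
    the equation at the other j follows by summation. *)
Lemma polynomial_coboundary kap n (W : nat -> R) : (0 < kap)%N ->
  (forall j, iter n fdiff W j = 0) ->
  exists g, (forall j, g (kap + j)%N - g j = W j) /\
    (forall j, iter n.+1 fdiff g j = 0).
Proof.
move=> kap0; elim: n W => [|n IH] W W0.
  exists (fun=> 0); split=> j; first by rewrite subrr; exact/esym/(W0 j).
  by rewrite iter_fdiff0.
have [|g' [g'W g'0]] := IH (fdiff W); first by move=> j; rewrite -iterSr.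
pose c := - (W 0 + \sum_(i < kap) g' i) / kap%:R.
pose g j := - (\sum_(i < j) g' i) - c * j%:R.
have Dg : fdiff g = fun j => g' j + c.
  apply/funext => j; rewrite /fdiff /g big_ord_recr /= -natr1; ring.
exists g; split=> j; last by rewrite iterSr Dg iter_fdiffDc.
have D1 i : fdiff (fun j => g (kap + j)%N - g j) i = fdiff W i.
  have -> : fdiff (fun j => g (kap + j)%N - g j) i =
            fdiff g (kap + i)%N - fdiff g i.
    by rewrite /fdiff addnS; ring.
  by rewrite Dg -g'W; ring.
rewrite [LHS](fdiff_sum (fun j => g (kap + j)%N - g j)) [RHS]fdiff_sum.
rewrite (eq_bigr _ (fun (i : 'I_j) _ => D1 i)); congr (_ - _).
rewrite addn0 /g big_ord0 /c; field.
by rewrite pnatr_eq0 -lt0n.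
Qed.

(** By induction the differences of f are constant, that is f is affine, and a
    periodic affine sequence has slope 0. *)
Lemma periodic_fdiff_const kap m f : (0 < kap)%N ->
  (forall j, f (kap + j)%N = f j) -> (forall j, iter m.+1 fdiff f j = 0) ->
  forall j, f j = f 0.
Proof.
move=> kap0; elim: m f => [|m IH] f fper f0.
  by move=> j; rewrite fdiff_sum big1 ?subr0// => i _; exact: f0.
have Dc : forall j, fdiff f j = fdiff f 0.
  apply: IH => j; last by rewrite -iterSr.
  by rewrite /fdiff -addnS !fper.
have fE j : f j = f 0 - fdiff f 0 * j%:R.
  rewrite fdiff_sum (eq_bigr (fun=> fdiff f 0)); last by move=> i _.
  by rewrite sumr_const card_ord mulr_natr.
have := fper 0; rewrite addn0 fE => /eqP.
rewrite -subr_eq0 addrAC subrr sub0r oppr_eq0 mulf_eq0 pnatr_eq0 (gtn_eqF kap0) orbF.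
by move=> /eqP d0 j; rewrite fE d0 mul0r subr0.
Qed.

End Differences.

(** * The masses of the levels of the branches *)

Section LevelMasses.
Context (R : realType).

Lemma esum_pickle (I : countType) (a : I -> \bar R) : (forall i, 0 <= a i)%E ->
  (\esum_(i in [set: I]) a i =
   \sum_(n <oo) (if @pickle_inv I n is Some i then a i else 0))%E.
Proof.
move=> a0; have IE : [set: I] = \bigcup_n [set i | pickle i = n].
  by apply/seteqP; split=> // i _; exists (pickle i).
rewrite IE esum_bigcupT//; last by move=> i j _ _ [x [/= <- <-]].
rewrite nneseries_esumT; last by move=> n; case: pickle_inv.
apply: eq_esum => n _; case E : (@pickle_inv I n) => [i|].
  rewrite -[RHS]esum_set1//; congr esum; apply/seteqP; split=> k /=.
    by move=> kn; have := @pickleK_inv I k; rewrite kn E => -[].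
  by move=> ->; have := @pickle_invK I n; rewrite E.
apply: esum1 => k /= kn; have := @pickleK_inv I k; by rewrite kn E.
Qed.

Context (eta : option nat) (w : J eta -> {poly R}).

(** The sum over the branches, finite or not, is turned into a series over nat
    with zero terms at the integers that encode no branch; sequences have the
    limit theorems needed below.  Heights [j] start at 0, as in [Branch i j]. *)
Definition branch_term (n j : nat) : R :=
  if @pickle_inv (J eta) n is Some i then (w i).[j.+1%:R] else 0.

Definition level_mass (j : nat) : R := fine (\sum_(n <oo) (branch_term n j)%:E).

Variables (M : R).
Hypothesis w_pos : forall i (j : nat), (0 < j)%N -> 0 < (w i).[j%:R].
Hypothesis w_sum : (\esum_(i in [set: J eta]) ((w i).[1])%:E <= M%:E)%E.
Hypothesis w_ratio : forall i j, (w i).[j.+2%:R] <= M * (w i).[j.+1%:R].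
Hypothesis M_gt0 : 0 < M.

Lemma branch_term_ge0 n j : 0 <= branch_term n j.
Proof. by rewrite /branch_term; case: pickle_inv => // i; rewrite ltW ?w_pos. Qed.

(** The series converges at height 0 by assumption, and the ratio bound carries
    convergence from each height to the next. *)
Lemma level_massE j : (\sum_(n <oo) (branch_term n j)%:E)%E = (level_mass j)%:E.
Proof.
rewrite /level_mass fineK// ge0_fin_numE; last first.
  by apply: nneseries_ge0 => n _ _; rewrite lee_fin branch_term_ge0.
elim: j => [|j IH].
  apply: le_lt_trans (ltry M); apply: le_trans w_sum.
  rewrite esum_pickle; last by move=> i; rewrite lee_fin ltW// (w_pos i (ltn0Sn 0)).
  rewrite le_eqVlt; apply/orP; left; apply/eqP; apply: eq_eseriesr => n _.
  by rewrite /branch_term; case: pickle_inv.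
apply: (@le_lt_trans _ _ (\sum_(n <oo) (M%:E * (branch_term n j)%:E))%E).
  apply: lee_nneseries => n _; first by rewrite lee_fin branch_term_ge0.
  rewrite -EFinM lee_fin /branch_term; case: pickle_inv => [i|]; last by rewrite mulr0.
  exact: w_ratio.
rewrite nneseriesZl ?lte_mul_pinfty ?lee_fin ?ltW//.
by move=> n _; rewrite lee_fin branch_term_ge0.
Qed.

Lemma level_mass_cvg j : \sum_(n < N) branch_term n j @[N --> \oo] --> level_mass j.
Proof.
have : (\sum_(0 <= n < N) (branch_term n j)%:E)%E @[N --> \oo] --> (level_mass j)%:E.
  rewrite -level_massE; apply: is_cvg_nneseries => n _ _.
  by rewrite lee_fin branch_term_ge0.
move=> /fine_cvg; apply: cvg_trans; apply: near_eq_cvg; apply: nearW => N /=.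
by rewrite sumEFin big_mkord.
Qed.

(** The partial sums are polynomials of bounded degree, and an iterated
    difference involves finitely many values, so it passes to the limit. *)
Lemma iter_fdiff_level_mass n p : (forall i, (size (w i) <= n)%N) ->
  iter n fdiff level_mass p = 0.
Proof.
move=> szw; pose S N j := \sum_(k < N) branch_term k j.
have SW : iter n fdiff (S N) p @[N --> \oo] --> iter n fdiff level_mass p.
  exact: (iter_fdiff_cvg level_mass_cvg).
suff S0 N : iter n fdiff (S N) p = 0.
  move: SW; under eq_fun do rewrite S0.
  by move=> /(cvg_lim (@Rhausdorff R)) <-; rewrite lim_cst.
elim: N => [|N IH].
  rewrite -[RHS](@iter_fdiff0 R n p); congr (iter n _ _ p).
  by apply/funext => j; rewrite /S big_ord0.
have -> : iter n fdiff (S N.+1) p =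
    iter n fdiff (S N) p + iter n fdiff (branch_term N) p.
  rewrite !iter_fdiffE -big_split /=; apply: eq_bigr => k _.
  by rewrite /S big_ord_recr mulrDr.
rewrite IH add0r /branch_term; case: pickle_inv => [i|]; last exact: iter_fdiff0.
rewrite -[RHS](iter_fdiff_poly 1 p (szw i)); congr (iter n _ _ p).
by apply/funext => j; rewrite -natr1 addrC.
Qed.

End LevelMasses.

(** * The equation for the masses of the core *)

Section Unrolling.
Context {R : realType}.
Variables (kappa : nat) (W : nat -> R).
Implicit Types a : nat -> R.

(** The mass of phi^-k(core p) depends on p + k only; this is its value at
    j = p + k, for core masses [a] and level masses [W].  It has this meaning for
    j < 2 * kappa, that is up to one turn around the cycle beyond the core. *)
Definition unroll a (j : nat) : R :=
  if (j < kappa)%N then a j else a (j - kappa)%N + W (j - kappa).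

Definition core_solution (m : nat) a : Prop :=
  forall p, (p < kappa)%N -> iter m fdiff (unroll a) p = 0.

Variable m : nat.
Hypothesis m_gt0 : (0 < m)%N.
Hypothesis m_lt : (m < kappa)%N.

Let kappa_gt0 : (0 < kappa)%N. Proof. exact: leq_ltn_trans m_lt. Qed.

Lemma core_solution_shift a (t : R) :
  core_solution m a -> core_solution m (fun p => a p + t).
Proof.
move=> sa p pk; rewrite -(sa p pk); case: (m) m_gt0 => // m' _.
rewrite -[RHS](iter_fdiffDc _ _ t); congr (iter _ _ _ p); apply/funext => j.
by rewrite /unroll; case: ifP => // _; ring.
Qed.

Lemma eq_core_solution a b : (forall p, (p < kappa)%N -> a p = b p) ->
  core_solution m a -> core_solution m b.
Proof.
move=> ab sa p pk; rewrite -(sa p pk); apply: eq_iter_fdiff => j jm.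
rewrite /unroll; case: ifP => [/ab //|/negbT]; rewrite -leqNgt => kpj.
rewrite ab// ltn_subLR//.
by apply: (leq_ltn_trans (leq_add (ltnW pk) jm)); rewrite ltn_add2l.
Qed.

Lemma core_solution_exists : (forall j, iter m.-1 fdiff W j = 0) ->
  exists a, core_solution m a.
Proof.
move=> W0; have [g [gW g0]] := polynomial_coboundary kappa_gt0 W0.
exists g => p pk; rewrite -[RHS](g0 p) prednK//; apply: eq_iter_fdiff => j _.
rewrite /unroll; case: ifP => // /negbT; rewrite -leqNgt => kpj.
by rewrite -gW subnKC// addrCA subrr addr0.
Qed.

(** In the difference of two unrolled sequences the contribution of W cancels, so
    it is the kappa-periodic extension of a - b. *)
Lemma core_solution_unique a b : core_solution m a -> core_solution m b ->
  forall p, (p < kappa)%N -> a p = b p + (a 0 - b 0).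
Proof.
move=> sa sb; pose e j := a (j %% kappa)%N - b (j %% kappa)%N.
have e_per j : e (kappa + j)%N = e j by rewrite /e modnDl.
have e0 q : iter m fdiff e q = 0.
  have -> : iter m fdiff e q = iter m fdiff e (q %% kappa)%N.
    rewrite !iter_fdiffE; apply: eq_bigr => k _; congr (_ * _).
    by rewrite /e modnDml.
  have qk : (q %% kappa < kappa)%N by rewrite ltn_mod.
  rewrite -[RHS](subrr 0) -[X in X - _](sa _ qk) -[X in _ - X](sb _ qk).
  rewrite -iter_fdiffB; apply: eq_iter_fdiff => j jm.
  rewrite /unroll /e; case: ifP => [jk|/negbT]; first by rewrite modn_small.
  rewrite -leqNgt => kpj; set r := (_ + j)%N in kpj *.
  have rk : (r - kappa < kappa)%N.
    rewrite ltn_subLR//.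
    by apply: (leq_ltn_trans (leq_add (ltnW qk) jm)); rewrite ltn_add2l.
  rewrite -(subnKC kpj) modnDl modn_small// addKn.
  by ring.
move=> p pk; move: e0; rewrite -(prednK m_gt0) => e0.
have := periodic_fdiff_const kappa_gt0 e_per e0 p.
rewrite /e !modn_small// => ep; rewrite -ep; ring.
Qed.

End Unrolling.

(** * The masses of the preimages in the graph *)

Section VertexMasses.
Context (R : realType) (kappa : nat) (eta : option nat).
Hypothesis kappa_gt0 : (0 < kappa)%N.
Local Notation X := (vertex kappa eta).
Local Notation phi := (@phi kappa eta).

Definition core (p : nat) : X := Core (inord p).
Definition level (j : nat) : set X := [set x | exists i, x = Branch i j].

Lemma ltn_core (p : 'I_kappa.-1.+1) : (p < kappa)%N.
Proof. by have := ltn_ord p; rewrite [X in (_ < X)%N]prednK. Qed.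

Lemma core_nat (p : 'I_kappa.-1.+1) : Core p = core p.
Proof. by rewrite /core inord_val. Qed.

Lemma core_inj p q : (p < kappa)%N -> (q < kappa)%N -> core p = core q -> p = q.
Proof.
move=> pk qk [/(congr1 val)] /=.
by rewrite !inordK ?prednK.
Qed.

Lemma phi_core0 : phi (core 0) = core kappa.-1.
Proof.
rewrite /core /= ifT; last by apply/eqP/val_inj; rewrite /= inordK.
by congr Core; apply/val_inj; rewrite /= inordK.
Qed.

Lemma phi_coreS p : (p.+1 < kappa)%N -> phi (core p.+1) = core p.
Proof.
move=> pk; rewrite /core /= ifF; last first.
  by apply/negP => /eqP/(congr1 val); rewrite /= inordK// prednK.
by rewrite inordK// prednK.
Qed.

Lemma preimage_core p : (p.+1 < kappa)%N -> phi @^-1` [set core p] = [set core p.+1].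
Proof.
move=> pk; apply/seteqP; split=> [x /= | x /= ->]; last exact: phi_coreS.
have p_lt : (p < kappa)%N := ltn_trans (ltnSn p) pk.
case: x => [q|i [|j]] //.
- rewrite core_nat; case: q => -[|q] qk; rewrite [nat_of_ord _]/=.
    rewrite phi_core0 => /core_inj E; move: pk; rewrite -E ?prednK ?ltnn//.
  rewrite prednK// in qk; rewrite phi_coreS// => /core_inj ->//.
  exact: ltn_trans (ltnSn q) qk.
- rewrite /Defs.phi -[ord_max]inord_val -/(core _) => /core_inj /= E.
  by move: pk; rewrite -E ?prednK ?ltnn.
Qed.

Lemma preimage_core_last :
  phi @^-1` [set core kappa.-1] = [set core 0] `|` level 0.
Proof.
apply/seteqP; split=> [x /= | x /= [->|[i ->]]]; last 2 first.
- exact: phi_core0.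
- by rewrite /Defs.phi -[ord_max]inord_val.
case: x => [q|i [|j]] // xE; last by right; exists i.
left; move: xE; rewrite core_nat; case: q => -[|q] qk; rewrite [nat_of_ord _]/= //.
rewrite prednK// in qk; rewrite phi_coreS// => /core_inj E.
move: (qk); rewrite E ?prednK ?ltnn//.
exact: ltn_trans (ltnSn q) qk.
Qed.

Lemma preimage_branch i j k :
  iter k phi @^-1` [set Branch i j] = [set Branch i (j + k)].
Proof.
elim: k j => [|k IH] j; first by rewrite addn0.
rewrite addnS -addSn -IH; apply/seteqP; split=> x /=; last by move=> ->.
by case: (iter k phi x) => [q|i' [|j']] //=; [case: ifP|move=> [-> ->]].
Qed.

Lemma preimage_level k : iter k phi @^-1` (level 0) = level k.
Proof.
apply/seteqP; split=> x; rewrite /level /=.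
  move=> [i xE]; exists i.
  suff : (iter k phi @^-1` [set Branch i 0]) x by rewrite preimage_branch add0n.
  exact: xE.
move=> [i ->]; exists i.
suff : (iter k phi @^-1` [set Branch i 0]) (Branch i k) by [].
by rewrite preimage_branch add0n.
Qed.

(** * Measures with given masses *)

Lemma measure_of_masses (b : X -> R) : (forall x, 0 <= b x) ->
  exists nu : {measure set X -> \bar R}, forall x, nu [set x] = (b x)%:E.
Proof.
move=> b0.
pose mu_ n : {measure set X -> \bar R} :=
  if @pickle_inv X n is Some x then mscale (NngNum (b0 x)) \d_x else mzero.
exists (mseries mu_ 0) => y; rewrite /mseries.
transitivity (\sum_(n <oo) (if @pickle_inv X n is Some x
    then (b x)%:E * \d_x [set y] else 0))%E.
  by apply: eq_eseriesr => n _; rewrite /mu_; case: pickle_inv.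
rewrite -(esum_pickle (a := fun x => ((b x)%:E * \d_x [set y])%E)); last first.
  by move=> x; rewrite mule_ge0// lee_fin.
rewrite -[RHS](esum_set1 (a := fun x => (b x)%:E)) ?lee_fin//.
rewrite [RHS]esum_mkcond; apply: eq_esum => x _.
by rewrite diracE; case: (x \in _); rewrite ?mule1 ?mule0.
Qed.

(** * The solutions of the core equation and the m-isometric extensions *)

Variable w : J eta -> {poly R}.
Variable M : R.
Hypothesis w_pos : forall i (j : nat), (0 < j)%N -> 0 < (w i).[j%:R].
Hypothesis w_sum : (\esum_(i in [set: J eta]) ((w i).[1])%:E <= M%:E)%E.
Hypothesis w_ratio : forall i j, (w i).[j.+2%:R] <= M * (w i).[j.+1%:R].
Hypothesis M_gt0 : 0 < M.

Section Masses.
Variable nu : {measure set X -> \bar R}.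
Hypothesis nu_pos : positive_masses nu.
Hypothesis nu_branch : branch_masses w nu.

Definition core_mass (p : nat) : R := fine (nu [set core p]).

Lemma core_massE p : nu [set core p] = (core_mass p)%:E.
Proof.
by have /andP[x0 xoo] := nu_pos (core p); rewrite fineK// ge0_fin_numE// ltW.
Qed.

Lemma core_mass_gt0 p : 0 < core_mass p.
Proof. by have /andP[] := nu_pos (core p); rewrite core_massE lte_fin. Qed.

Lemma measure_level j : nu (level j) = (level_mass w j)%:E.
Proof.
pose F n : set X := if @pickle_inv (J eta) n is Some i then [set Branch i j] else set0.
have -> : level j = \bigcup_n F n.
  apply/seteqP; split=> x.
    by move=> [i ->]; exists (pickle i) => //; rewrite /F pickleK_inv.
  by move=> [n _]; rewrite /F; case: pickle_inv => // i /= ->; exists i.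
rewrite measure_bigcup//; last first.
  move=> n k _ _ [x []]; rewrite /F.
  case En : (@pickle_inv (J eta) n) => [i|] //= ->.
  case Ek : (@pickle_inv (J eta) k) => [i'|] //= [ii'].
  have := @pickle_invK (J eta) n; have := @pickle_invK (J eta) k.
  by rewrite En Ek /= ii' => -> ->.
rewrite -(level_massE w_pos w_sum w_ratio M_gt0).
rewrite (eq_eseriesl (Q := xpredT)); last by move=> n; rewrite in_setT.
apply: eq_eseriesr => n _; rewrite /F /branch_term.
case: pickle_inv => [i|]; last exact: measure0.
exact: nu_branch.
Qed.

(** Induction on [k].  One step back from a core point is the next core point,
    except at the last one, where it is the first core point together with the
    level 0 of the branches; k further steps back send that level to level k. *)
Lemma preimage_core_mass k p : (k <= kappa)%N -> (p < kappa)%N ->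
  nu (iter k phi @^-1` [set core p]) =
  (unroll kappa (level_mass w) core_mass (p + k))%:E.
Proof.
elim: k p => [|k IH] p kk pk; first by rewrite addn0 /unroll pk core_massE.
have k_le : (k <= kappa)%N := ltnW kk.
rewrite (_ : iter k.+1 phi @^-1` [set core p] =
   iter k phi @^-1` (phi @^-1` [set core p]))//.
have := pk; rewrite leq_eqVlt => /orP[/eqP p_last|pS]; last first.
  by rewrite preimage_core// IH// addnS.
have -> : p = kappa.-1 by rewrite -p_last.
rewrite preimage_core_last preimage_setU preimage_level.
transitivity (nu (iter k phi @^-1` [set core 0]) + nu (level k))%E.
  rewrite -preimage_level; apply: measureU => //.
  by apply/seteqP; split=> x //= [+ [i xi]]; rewrite xi.
rewrite measure_level IH// -EFinD add0n; congr EFin.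
by rewrite addnS -addSn prednK// /unroll kk ltnNge leq_addr /= addKn.
Qed.

Lemma preimage_branch_mass k i j :
  nu (iter k phi @^-1` [set Branch i j]) = ((w i).[(j + k).+1%:R])%:E.
Proof. by rewrite preimage_branch nu_branch. Qed.

Lemma preimage_difference_core m p : (m <= kappa)%N -> (p < kappa)%N ->
  preimage_difference nu phi m (core p) =
  iter m fdiff (unroll kappa (level_mass w) core_mass) p.
Proof.
move=> mk pk; rewrite /preimage_difference iter_fdiffE.
apply: eq_bigr => k _; rewrite preimage_core_mass//.
by rewrite (leq_trans _ mk)// -ltnS.
Qed.

Lemma preimage_difference_branch m i j : (size (w i) <= m)%N ->
  preimage_difference nu phi m (Branch i j) = 0.
Proof.
move=> sw; rewrite -[RHS](iter_fdiff_poly 1 j sw) iter_fdiffE.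
apply: eq_bigr => k _; rewrite preimage_branch_mass/=.
by rewrite -[(j + k).+1%:R]natr1 addrC.
Qed.

Lemma level_mass_ge0 j : 0 <= level_mass w j.
Proof. by rewrite -lee_fin -measure_level. Qed.

(** The ratios are bounded by M on the branches, and there are finitely many core
    points: the sum of their ratios replaces the maximum. *)
Lemma fiber_mass_bound : exists2 c : R, 0 <= c &
  forall x, (nu (phi @^-1` [set x]) <= c%:E * nu [set x])%E.
Proof.
pose f p := unroll kappa (level_mass w) core_mass p.+1.
have f0 p : 0 <= f p.
  rewrite /f /unroll; case: ifP => _; first exact/ltW/core_mass_gt0.
  by rewrite addr_ge0 ?level_mass_ge0// ltW// core_mass_gt0.
have q0 (p : 'I_kappa.-1.+1) : 0 <= f p / core_mass p.
  by rewrite divr_ge0// ltW// core_mass_gt0.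
exists (M + \sum_(p < kappa.-1.+1) f p / core_mass p).
  by rewrite addr_ge0 ?sumr_ge0// ltW.
case=> [p|i j].
  rewrite core_nat -[phi]/(iter 1 phi) preimage_core_mass ?ltn_core//.
  rewrite core_massE -EFinM lee_fin addn1 -/(f p).
  rewrite -ler_pdivrMr ?core_mass_gt0// (bigD1 p)//= addrCA lerDl.
  by rewrite addr_ge0 ?sumr_ge0// ltW.
rewrite -[phi]/(iter 1 phi) preimage_branch_mass nu_branch -EFinM lee_fin addn1.
rewrite mulrDl; apply: ler_wpDr; last exact: w_ratio.
by rewrite mulr_ge0 ?sumr_ge0// ltW// w_pos.
Qed.

(** The branches impose no condition, because the differences of the w_i of the
    relevant order vanish. *)
Lemma m_isometry_core_solution m : (m <= kappa)%N ->
  (forall i, (size (w i) <= m)%N) ->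
  L2_m_isometry nu m (composition_operator phi) <->
  core_solution kappa (level_mass w) m core_mass.
Proof.
move=> mk sw.
have meas (A : set X) : measurable A by [].
have inj : injective (pickle : X -> nat) := pcan_inj pickleK.
split=> [iso p pk|sol].
  by rewrite -preimage_difference_core// (m_isometry_preimage meas nu_pos iso).
have [c c0 fib] := fiber_mass_bound.
apply: (preimage_m_isometry meas inj nu_pos c0 fib) => -[p|i j].
  by rewrite core_nat preimage_difference_core ?sol ?ltn_core.
exact: preimage_difference_branch.
Qed.

End Masses.

Lemma extension_of_core_solution m a : (m < kappa)%N ->
  (forall i, (size (w i) <= m)%N) ->
  (forall p, (p < kappa)%N -> 0 < a p) ->
  core_solution kappa (level_mass w) m a ->
  exists nu : {measure set X -> \bar R}, m_isometric_extension m w nu /\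
    forall p : 'I_kappa.-1.+1, nu [set Core p] = (a p)%:E.
Proof.
move=> mk sw a0 sol.
pose b (x : X) : R := match x with Core p => a p | Branch i j => (w i).[j.+1%:R] end.
have b_gt0 x : 0 < b x by case: x => [p|i j]; [exact/a0/ltn_core|exact: w_pos].
have [nu nuE] := measure_of_masses (fun x => ltW (b_gt0 x)).
have pos : positive_masses nu by move=> x; rewrite nuE ltry lte_fin b_gt0.
have br : branch_masses w nu by move=> i j; rewrite nuE.
exists nu; split; last by move=> p; rewrite nuE.
split=> //; apply/(m_isometry_core_solution pos br (ltnW mk) sw).
apply: (eq_core_solution mk _ sol) => p pk.
by rewrite /core_mass nuE /= inordK// prednK.
Qed.

End VertexMasses.

(** * The one-parameter family *)

Theorem proposition3p4 (R : realType) (m kappa : nat)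
  (hm : (2 <= m)%N) (hkappa : (m < kappa)%N)
  (eta : option nat) (heta : eta <> Some 0%N)
  (M : R) (hM : 0 < M)
  (w : J eta -> {poly R})
  (w_deg : forall i, ((size (w i)).-1 <= m - 2)%N)
  (w_pos : forall i (j : nat), (0 < j)%N -> 0 < (w i).[j%:R])
  (w_bound :
    (maxe (\esum_(i in [set: J eta]) ((w i).[1])%:E)
       (ereal_sup [set r | exists i (j : nat), (0 < j)%N /\
          r = ((w i).[j.+1%:R] / (w i).[j%:R])%:E])
     <= M%:E)%E) :
  exists mu : {measure set (vertex kappa eta) -> \bar R},
    m_isometric_extension m w mu /\
    exists t0 : R,
      (forall t : R, t0 < t ->
         exists nu : {measure set (vertex kappa eta) -> \bar R},
           m_isometric_extension m w nu /\ is_core_shift mu t nu) /\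
      (forall nu : {measure set (vertex kappa eta) -> \bar R},
         m_isometric_extension m w nu ->
         exists! t : R, t0 < t /\ is_core_shift mu t nu).
Proof.
have m_gt0 : (0 < m)%N := ltnW hm.
have kappa_gt0 : (0 < kappa)%N := ltn_trans m_gt0 hkappa.
have mk : (m <= kappa)%N := ltnW hkappa.
have szw i : (size (w i) <= m.-1)%N.
  by have := w_deg i; case: (size _) => //= n; case: (m) hm => [|[|m']] //=; rewrite subn2.
have sz i : (size (w i) <= m)%N := leq_trans (szw i) (leq_pred m).
move: w_bound; rewrite ge_max => /andP[w_sum w_sup].
have w_ratio i j : (w i).[j.+2%:R] <= M * (w i).[j.+1%:R].
  rewrite -ler_pdivrMr ?w_pos// -lee_fin; apply: le_trans w_sup.
  by apply: ereal_sup_ubound; exists i, j.+1.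
have core_solutionP (nu : {measure set (vertex kappa eta) -> \bar R}) :=
  @m_isometry_core_solution _ _ _ kappa_gt0 w M w_pos w_sum w_ratio hM nu.
have extension := @extension_of_core_solution _ _ _ kappa_gt0 w M w_pos w_sum w_ratio hM m.
have [a0 sol0] := core_solution_exists m_gt0 hkappa
  (fun j => iter_fdiff_level_mass w_pos w_sum w_ratio hM j szw).
(* large enough to make all the core masses positive *)
pose s := 1 + \sum_(p < kappa) `|a0 p|.
pose a p := a0 p + s.
have a_gt0 p : (p < kappa)%N -> 0 < a p.
  move=> pk; rewrite /a /s (bigD1 (Ordinal pk))//=.
  have : 0 <= \sum_(i < kappa | i != Ordinal pk) `|a0 i| by rewrite sumr_ge0.
  by have := ler_norm (- a0 p); rewrite normrN; lra.
have sol : core_solution kappa (level_mass w) m a.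
  exact: core_solution_shift.
have [mu [mu_ext muE]] := extension _ hkappa sz a_gt0 sol.
exists mu; split=> //.
pose pmin : 'I_kappa.-1.+1 := [arg min_(p < ord0) a p]%O.
have aminP (p : 'I_kappa.-1.+1) : a pmin <= a p.
  by rewrite /pmin; case: arg_minP => // q _; apply.
exists (- a pmin); split=> [t t_gt|nu nu_ext].
  have at_gt0 p : (p < kappa)%N -> 0 < a p + t.
    move=> pk; have := aminP (inord p); rewrite inordK ?prednK//; lra.
  have [nu [nu_ext nuE]] := extension _ hkappa sz at_gt0 (core_solution_shift m_gt0 t sol).
  exists nu; split=> // -[p|i j]; first by rewrite nuE muE EFinD.
  by case: mu_ext nu_ext => _ muB _ [_ nuB _]; rewrite muB nuB.
case: (nu_ext) => nu_pos nu_br /(core_solutionP nu nu_pos nu_br m mk sz) nu_sol.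
have nuE := core_solution_unique m_gt0 hkappa nu_sol sol.
set t := core_mass nu 0 - a 0 in nuE.
have shift : is_core_shift mu t nu.
  move=> [p|i j]; last by case: mu_ext => _ muB _; rewrite muB nu_br.
  rewrite muE core_nat core_massE// nuE ?ltn_core// EFinD//.
exists t; split=> [|t' [_ shift']].
  split=> //; have := core_mass_gt0 nu_pos pmin; rewrite nuE ?ltn_core//; lra.
have := shift' (Core ord0); rewrite shift muE -!EFinD => -[]; lra.
Qed.
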